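(* Consider the optimization problem $\min_{\boldsymbol x\in\mathcal{X}}f(\boldsymbol x)$, where $\mathcal{X}:=\{\boldsymbol x\in\mathbb{R}^n:\mathbf{A}\boldsymbol x=\mathbf{b},\ \boldsymbol x\ge\boldsymbol 0\}$ is not a singleton, with $\mathbf{A}\in\mathbb{R}^{m\times n}$ and $\mathbf{b}\in\mathbb{R}^m$. Assume that $f$ is continuously differentiable on $\mathcal{X}$, and that the separable kernel function $h$ satisfies $\operatorname{cl}(\operatorname{dom}(h))=\mathbb{R}^n_+$. Then every non-stationary vertex of $\mathcal{X}$ is a spurious stationary point.
   Context: The problem is viewed as minimizing $F=f+g$ over $\mathbb{R}^n$, with $f:\mathbb{R}^n\to\mathbb{R}$ and $g=\delta_{\mathcal{X}}$ (the indicator function: $0$ on $\mathcal{X}$, $+\infty$ elsewhere). Separable kernel function: $h:\mathbb{R}^n\to\overline{\mathbb{R}}$ is a separable kernel function if (1) $h(\boldsymbol x)=\sum_{i=1}^n\varphi(x_i)$ for some $\varphi:\mathbb{R}\to\overline{\mathbb{R}}$ that is continuously differentiable on $\operatorname{int}(\operatorname{dom}\varphi)$; (2) for every sequence $\{x^k\}\subset\operatorname{int}(\operatorname{dom}\varphi)$ converging to a point of $\operatorname{bd}(\operatorname{dom}\varphi)$, $|\varphi'(x^k)|\to+\infty$; (3) $\varphi$ is strictly convex. Affine manifold: $\mathcal{B}(\boldsymbol x)=\{b\in[n]:x_b\in\operatorname{bd}(\operatorname{dom}\varphi)\}$, $\mathcal{M}(\boldsymbol x)=\{\boldsymbol y\in\mathbb{R}^n:\boldsymbol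 y_{\mathcal{B}(\boldsymbol x)}=\boldsymbol x_{\mathcal{B}(\boldsymbol x)}\}$, with tangent space $T_{\mathcal{M}(\boldsymbol x)}=\{\boldsymbol v\in\mathbb{R}^n:\boldsymbol v_{\mathcal{B}(\boldsymbol x)}=\boldsymbol 0\}$. For $\boldsymbol u\in\mathcal{M}(\boldsymbol x)$: $\nabla_{\mathcal{M}(\boldsymbol x)}f(\boldsymbol u):=\operatorname{proj}_{T_{\mathcal{M}(\boldsymbol x)}}(\nabla f(\boldsymbol u))$ and $\partial_{\mathcal{M}(\boldsymbol x)}g(\boldsymbol u):=\{\boldsymbol v\in T_{\mathcal{M}(\boldsymbol x)}:g(\boldsymbol y)-g(\boldsymbol u)\ge\boldsymbol v^\top(\boldsymbol y-\boldsymbol u)\ \forall\boldsymbol y\in\mathcal{M}(\boldsymbol x)\}$. Stationarity: $\partial F(\boldsymbol x)=\nabla f(\boldsymbol x)+\partial g(\boldsymbol x)$ with $\partial g$ the convex subdifferential; $\boldsymbol x\in\mathcal{X}$ is stationary if $\boldsymbol 0\in\partial F(\boldsymbol x)$ and non-stationary otherwise. A point $\boldsymbol x\in\mathcal{X}$ is a spurious stationary point if $\boldsymbol 0\in\nabla_{\mathcal{M}(\boldsymbol x)}f(\boldsymbol x)+\partial_{\mathcal{M}(\boldsymbol x)}g(\boldsymbol x)$ but $\boldsymbol 0\notin\partial F(\boldsymbol x)$. *)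

(* Defs.v *)
From mathcomp Require Import all_boot all_order all_algebra.
From mathcomp Require Import all_classical all_reals all_analysis.

Set Implicit Arguments.
Unset Strict Implicit.
Unset Printing Implicit Defensive.

Import Order.TTheory GRing.Theory Num.Theory.
Import numFieldNormedType.Exports.

Local Open Scope classical_set_scope.
Local Open Scope ring_scope.

Definition boundary (T : topologicalType) (A : set T) : set T :=
  closure A `\` A°.

Definition edom (R : realType) (T : Type) (f : T -> \bar R) : set T :=
  [set x | (f x < +oo)%E].

(* The norm of the library on 'cV[R]_n is the sup norm, so Euclidean notions
   go through the dot product. *)
Definition dot (R : realType) (n : nat) (u v : 'cV[R]_n) : R :=
  \sum_(i < n) u i 0 * v i 0.

Definition euclid_proj (R : realType) (n : nat) (C : set 'cV[R]_n)
    (v : 'cV[R]_n) : 'cV[R]_n :=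
  get [set p | C p /\ forall w, C w -> dot (v - p) (v - p) <= dot (v - w) (v - w)].

Definition grad (R : realType) (n : nat) (f : 'cV[R]_n -> R)
    (x : 'cV[R]_n) : 'cV[R]_n :=
  \col_(i < n) 'D_(delta_mx i 0) f x.

(* X need not be open: f is defined on the whole space, differentiable at every
   point of X, and its gradient is continuous for the subspace topology of X. *)
Definition cont_diff_on (R : realType) (n : nat) (f : 'cV[R]_n -> R)
    (X : set 'cV[R]_n) : Prop :=
  (forall x, X x -> differentiable f x) /\ {within X, continuous (grad f)}.

(* Imposed on pairs of points of the domain; such a function never takes the
   value -oo as soon as its domain has two points. *)
Definition strictly_convex (R : realType) (phi : R -> \bar R) : Prop :=
  forall s t l : R, edom phi s -> edom phi t -> s != t -> 0 < l < 1 ->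
    (phi (l * s + (1 - l) * t)%R < l%:E * phi s + (1 - l)%:E * phi t)%E.

Record separable_kernel (R : realType) (n : nat) (phi : R -> \bar R)
    (h : 'cV[R]_n -> \bar R) : Prop := SeparableKernel {
  kernel_sum : forall x, h x = (\sum_(i < n) phi (x i 0)%R)%E;
  kernel_C1 : forall t, (edom phi)° t ->
    derivable (fine \o phi) t 1 /\ {for t, continuous (derive1 (fine \o phi))};
  kernel_steep : forall (u : nat -> R) (l : R),
    (forall k, (edom phi)° (u k)) -> u @ \oo --> l -> boundary (edom phi) l ->
    `|derive1 (fine \o phi) (u k)| @[k --> \oo] --> +oo;
  kernel_strictly_convex : strictly_convex phi }.

Definition bd_coords (R : realType) (n : nat) (phi : R -> \bar R)
    (x : 'cV[R]_n) : set 'I_n :=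
  [set i | boundary (edom phi) (x i 0)].

Definition manifold (R : realType) (n : nat) (phi : R -> \bar R)
    (x : 'cV[R]_n) : set 'cV[R]_n :=
  [set y | forall i, bd_coords phi x i -> y i 0 = x i 0].

Definition tangent (R : realType) (n : nat) (phi : R -> \bar R)
    (x : 'cV[R]_n) : set 'cV[R]_n :=
  [set v | forall i, bd_coords phi x i -> v i 0 = 0].

Definition grad_manifold (R : realType) (n : nat) (phi : R -> \bar R)
    (x : 'cV[R]_n) (f : 'cV[R]_n -> R) (u : 'cV[R]_n) : 'cV[R]_n :=
  euclid_proj (tangent phi x) (grad f u).

(* In both subdifferentials below, when g u = +oo the left-hand side is -oo for
   every y, so that the subdifferential is empty, as usual. *)
Definition subdiff_manifold (R : realType) (n : nat) (phi : R -> \bar R)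
    (x : 'cV[R]_n) (g : 'cV[R]_n -> \bar R) (u : 'cV[R]_n) : set 'cV[R]_n :=
  [set v | tangent phi x v /\
     forall y, manifold phi x y -> ((dot v (y - u))%:E <= g y - g u)%E].

Definition subdiff (R : realType) (n : nat) (g : 'cV[R]_n -> \bar R)
    (u : 'cV[R]_n) : set 'cV[R]_n :=
  [set v | forall y, ((dot v (y - u))%:E <= g y - g u)%E].

Definition indicator (R : realType) (n : nat) (X : set 'cV[R]_n)
    (x : 'cV[R]_n) : \bar R :=
  if x \in X then 0%E else +oo%E.

Definition subdiff_objective (R : realType) (n : nat) (f : 'cV[R]_n -> R)
    (X : set 'cV[R]_n) (x : 'cV[R]_n) : set 'cV[R]_n :=
  [set grad f x + v | v in subdiff (indicator X) x].

Definition non_stationary (R : realType) (n : nat) (f : 'cV[R]_n -> R)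
    (X : set 'cV[R]_n) (x : 'cV[R]_n) : Prop :=
  X x /\ ~ subdiff_objective f X x 0.

Definition spurious_stationary (R : realType) (n : nat) (phi : R -> \bar R)
    (f : 'cV[R]_n -> R) (X : set 'cV[R]_n) (x : 'cV[R]_n) : Prop :=
  [/\ X x,
      [set grad_manifold phi x f x + v
         | v in subdiff_manifold phi x (indicator X) x] 0
    & ~ subdiff_objective f X x 0].

Definition nonneg_orthant (R : realType) (n : nat) : set 'cV[R]_n :=
  [set x | forall i, 0 <= x i 0].

Definition polyhedron (R : realType) (m n : nat) (A : 'M[R]_(m, n))
    (b : 'cV[R]_m) : set 'cV[R]_n :=
  [set x | A *m x = b] `&` @nonneg_orthant R n.

(* The vertices of a polyhedron are its extreme points. *)
Definition vertex (R : realType) (n : nat) (X : set 'cV[R]_n)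
    (x : 'cV[R]_n) : Prop :=
  X x /\ forall (y z : 'cV[R]_n) (l : R), X y -> X z -> 0 < l < 1 ->
    x = l *: y + (1 - l) *: z -> y = x /\ z = x.

(* Main.v *)
(** If [y] in [X] vanishes wherever the vertex [x] does, then [x] can be moved a
    little away from [y] inside [X], so that [x] lies strictly between two points
    of [X]; hence [y = x].  Since [0] is a boundary point of [dom phi], every
    point of [M(x)] in [X] is of this kind.  So the indicator of [X] restricted
    to [M(x)] is that of [{x}], and its subdifferential at [x] is the whole
    tangent space, which contains the opposite of the projected gradient. *)
Require Import Defs.
From mathcomp Require Import all_boot all_order all_algebra.
From mathcomp Require Import all_classical all_reals all_analysis.
Import Order.TTheory GRing.Theory Num.Theory.
Import numFieldNormedType.Exports.
Local Open Scope classical_set_scope.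
Local Open Scope ring_scope.

Lemma vertex_support_unique (R : realType) (m n : nat) (A : 'M[R]_(m, n))
    (b : 'cV[R]_m) (x y : 'cV[R]_n) :
  vertex (polyhedron A b) x -> polyhedron A b y ->
  (forall i, x i 0 = 0 -> y i 0 = 0) -> y = x.
Proof.
move=> [[Ax x_ge0] x_extreme] [Ay y_ge0] supp_yx.
have ratio_ge0 i : 0 <= y i 0 / x i 0 by rewrite divr_ge0.
(* [C] bounds every ratio, which keeps [x - C^-1 *: y] nonnegative; the 2 forces [C^-1 < 1]. Where
   [x i 0 = 0] the ratio is 0 by convention. *)
pose C := 2 + \sum_i y i 0 / x i 0.
have C_ge2 : 2 <= C by rewrite lerDl sumr_ge0.
have C_gt0 : 0 < C by apply: lt_le_trans C_ge2.
have y_le i : y i 0 <= C * x i 0.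
  have [xi0|xi_neq0] := eqVneq (x i 0) 0; first by rewrite xi0 supp_yx // mulr0.
  rewrite -ler_pdivrMr ?lt0r ?xi_neq0 ?x_ge0 // /C (bigD1 i) //= addrCA lerDl.
  by rewrite addr_ge0 // sumr_ge0.
have l_gt0 : 0 < C^-1 by rewrite invr_gt0.
have l_lt1 : C^-1 < 1.
  by rewrite invf_lt1 //; apply: lt_le_trans C_ge2; rewrite ltr1n.
have k_gt0 : 0 < 1 - C^-1 by rewrite subr_gt0.
(* Solution of [x = C^-1 *: y + (1 - C^-1) *: z]. *)
pose z := (1 - C^-1)^-1 *: (x - C^-1 *: y).
have Xz : polyhedron A b z.
  split=> /=.
    rewrite -scalemxAr; have -> : A *m (x - C^-1 *: y) = (1 - C^-1) *: b.
      by rewrite mulmxBr -scalemxAr Ax Ay scalerBl scale1r.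
    by rewrite scalerA mulVf ?scale1r // gt_eqF.
  move=> i; rewrite !mxE mulr_ge0 ?invr_ge0 ?(ltW k_gt0) // subr_ge0.
  by rewrite ler_pdivrMl.
have [] // := x_extreme y z C^-1; first by rewrite l_gt0.
by rewrite /z scalerA divff ?gt_eqF // scale1r addrC subrK.
Qed.

Lemma sume_eqy (R : realType) (I : finType) (i0 : I) (F : I -> \bar R) :
  (forall i, F i = +oo%E) -> (\sum_i F i = +oo)%E.
Proof.
move=> Fy; rewrite (bigD1 i0) //= Fy addye // gt_eqF //.
by apply: (@lt_le_trans _ _ 0%E) => //; apply: sume_ge0 => i _; rewrite Fy.
Qed.

(** Constant vectors show that the domain of [phi] has no negative point; vectors of the domain of
    [h] near 0 give points of it near 0. The index [i0] excludes [n = 0]. *)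
Lemma boundary_edom0 (R : realType) (n : nat) (phi : R -> \bar R)
    (h : 'cV[R]_n -> \bar R) (i0 : 'I_n) :
  (forall x, h x = (\sum_(i < n) phi (x i 0)%R)%E) ->
  closure (edom h) = @nonneg_orthant R n -> boundary (edom phi) 0.
Proof.
move=> hE h_dom.
have edom_ge0 t : edom phi t -> 0 <= t.
  move=> phit.
  have : closure (edom h) (const_mx t).
    apply: subset_closure; rewrite /edom /= hE.
    by apply: lte_sum_pinfty => i _; rewrite mxE.
  by rewrite h_dom => /(_ i0); rewrite mxE.
split.
  have : closure (edom h) 0 by rewrite h_dom => i; rewrite mxE.
  move=> h0 U /nbhs_ballP[e /= e_gt0 eU].
  have [x [hx x_near]] := h0 _ (nbhsx_ballx (0 : 'cV[R]_n) e e_gt0).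
  (* Only one coordinate of x needs to be in the domain of phi; this holds
     even if phi takes the value -oo, where -oo + +oo = -oo. *)
  have [i phixi] : exists i, edom phi (x i 0).
    apply: contrapT => /forallNP no_i.
    move: hx; rewrite /edom /= hE (sume_eqy _ _ i0) ?ltxx // => i.
    by apply/eqP; rewrite -leye_eq leNgt; apply/negP; exact: no_i.
  exists (x i 0); split => //; apply: eU.
  by case: x_near => _ /(_ i 0); rewrite mxE.
rewrite /interior /= => /nbhs_ballP[e /= e_gt0 e_dom].
have : edom phi (- (e / 2)).
  apply: e_dom; rewrite /ball /= sub0r opprK gtr0_norm ?divr_gt0 //.
  by rewrite ltr_pdivrMr // ltr_pMr // ltr1n.
by move=> /edom_ge0; rewrite oppr_ge0 leNgt divr_gt0.
Qed.

(** The value of [get] is a minimizer only if one exists: zeroing the coordinates of [v] in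
    [bd_coords phi x] provides it. *)
Lemma euclid_proj_tangent (R : realType) (n : nat) (phi : R -> \bar R)
    (x v : 'cV[R]_n) : tangent phi x (euclid_proj (tangent phi x) v).
Proof.
pose p : 'cV[R]_n := \col_i (if `[< bd_coords phi x i >] then 0 else v i 0).
suff /getPex[] : exists p, tangent phi x p /\
  forall w, tangent phi x w -> dot (v - p) (v - p) <= dot (v - w) (v - w) by [].
exists p; split=> [i bdi|w Tw]; first by rewrite mxE asboolT.
apply: ler_sum => i _; rewrite !mxE.
case: asboolP => [bdi|_]; first by rewrite Tw.
by rewrite subrr mulr0 -expr2 sqr_ge0.
Qed.

Theorem theorem3p3 (R : realType) (m n : nat) (A : 'M[R]_(m, n)) (b : 'cV[R]_m)
    (f : 'cV[R]_n -> R) (phi : R -> \bar R) (h : 'cV[R]_n -> \bar R)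
    (X_not_singleton : ~ exists x : 'cV[R]_n, polyhedron A b = [set x])
    (f_C1 : cont_diff_on f (polyhedron A b))
    (h_kernel : separable_kernel phi h)
    (h_dom : closure (edom h) = @nonneg_orthant R n) :
  forall x : 'cV[R]_n,
    vertex (polyhedron A b) x -> non_stationary f (polyhedron A b) x ->
    spurious_stationary phi f (polyhedron A b) x.
Proof.
move=> x vx [Xx nstat]; split=> //.
exists (- grad_manifold phi x f x); last by rewrite subrr.
split=> [i bdi|y My]; first by rewrite mxE euclid_proj_tangent ?oppr0.
rewrite /indicator (mem_set Xx) sube0.
(* Outside the polyhedron the right-hand side is [+oo]. *)
case: ifPn => [/set_mem Xy|_]; last exact: leey.
suff -> : y = x by rewrite subrr /dot big1 // => i _; rewrite [X in _ * X]mxE mulr0.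
apply: (vertex_support_unique _ _ _ _ _ _ _ vx Xy) => i xi0.
rewrite My // /bd_coords /= xi0.
exact: (boundary_edom0 _ _ _ _ i) (kernel_sum h_kernel) h_dom.
Qed.
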